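(* Let $f\sim\mathcal{GP}(0,\kappa)$ be a zero-mean Gaussian process with a given positive-definite covariance function $\kappa:\mathcal S\times\mathcal S\to\mathbb R$. Assume we are given a sequence of observations $y_n=f(x_n)+\epsilon_n$, where $x_n\in\mathcal S$ and $\epsilon_n$ is $\sigma_\epsilon^2$-sub-Gaussian noise, for all $n\in\mathbb N$. Let $\mu_n$ and $\sigma_n^2$ denote the predictive mean and variance, respectively, of the GP posterior (given the first $n$ observations) under the assumption that the noise is zero-mean Gaussian with variance given by $\sigma_\epsilon^2$. Then, for all $n\ge 0$ and all $x\in\mathcal S$, we have that $f(x)-\mu_n(x)$ is $\sigma_n^2(x)$-sub-Gaussian.
   Context: $\mathcal S$ is the domain (a set) on which the process $f$ is indexed. A real random variable $\epsilon$ is called $\sigma^2$-sub-Gaussian if $\mathbb E[\exp(s\epsilon)]\le\exp(\tfrac12 s^2\sigma^2)$ for all $s\in\mathbb R$. GP posterior: with $X_n=\{x_1,\dots,x_n\}$, $\mathbf y_n=(y_1,\dots,y_n)^\top$, $\mathbf K_n=[\kappa(x_i,x_j)]_{i,j=1}^n$ and $\kappa(x,X_n)=[\kappa(x,x_1),\dots,\kappa(x,x_n)]=\kappa(X_n,x)^\top$, $$\mu_n(x)=\kappa(x,X_n)(\mathbf K_n+\sigma_\epsilon^2\mathbf I)^{-1}\mathbf y_n,\qquad \sigma_n^2(x)=\kappa(x,x)-\kappa(x,X_n)(\mathbf K_n+\sigma_\epsilon^2\mathbf I)^{-1}\kappa(X_n,x),$$ with $\mu_0(x)=0$ and $\sigma_0^2(x)=\kappa(x,x)$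 when there are no observations.
   Formalization: The process f and the noise variables ε_n are assumed mutually independent (the claim fails for, e.g., ε_1 = −f(x_1)); the points x_n are deterministic; if σ_ε = 0, the matrix K_n is assumed invertible so that the posterior is defined. *)

(* Defs.v *)
From HB Require Import structures.
From mathcomp Require Import all_boot all_order all_algebra finmap.
From mathcomp Require Import all_classical all_reals all_analysis.

Set Implicit Arguments.
Unset Strict Implicit.
Unset Printing Implicit Defensive.

Import Order.TTheory GRing.Theory Num.Theory.

Local Open Scope classical_set_scope.
Local Open Scope ring_scope.

(* [v] plays the role of sigma^2. Measurability is part of the definition since
   [X] is a bare function. *)
Definition subgaussian (d : measure_display) (T : measurableType d)
    (R : realType) (P : probability T R) (v : R) (X : T -> R) : Prop :=
  measurable_fun [set: T] X /\
  forall s : R, ('E_P[fun w => expR (s * X w)] <= (expR (s ^+ 2 * v / 2))%:E)%E.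

(* Gaussian law N(m, s^2). The case [s = 0] must be treated apart: the library
   sets [normal_prob m 0] to the uniform law on [0, 1], not to the point mass
   at [m]. *)
Definition gaussian_law (R : realType) (m s : R) (A : set R) : \bar R :=
  if s == 0 then \d_m A else normal_prob m s A.

Definition gaussian_rv (d : measure_display) (T : measurableType d)
    (R : realType) (P : probability T R) (X : T -> R) : Prop :=
  measurable_fun [set: T] X /\
  exists m s : R, forall A : set R, measurable A ->
    P (X @^-1` A) = gaussian_law m s A.

(* Jointly Gaussian, possibly degenerate: every linear combination of the
   coordinates is a univariate Gaussian. *)
Definition gaussian_vector (d : measure_display) (T : measurableType d)
    (R : realType) (P : probability T R) (n : nat) (X : 'I_n -> T -> R) : Prop :=
  forall a : 'I_n -> R, gaussian_rv P (fun w => \sum_(i < n) a i * X i w).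

(* GP(m, kappa): the finite-dimensional marginals are jointly Gaussian, with
   mean function [m] and covariance function [kappa]. *)
Definition gaussian_process (d : measure_display) (T : measurableType d)
    (R : realType) (P : probability T R) (S : Type)
    (m : S -> R) (kappa : S -> S -> R) (f : S -> {RV P >-> R}) : Prop :=
  [/\ forall (n : nat) (z : 'I_n -> S),
        gaussian_vector P (fun i => f (z i) : T -> R),
      forall x : S, ('E_P[f x] = (m x)%:E)%E
    & forall x x' : S, covariance P (f x) (f x') = (kappa x x')%:E].

(* As usual for kernels, "positive definite" means that all Gram matrices are
   symmetric and positive semi-definite. *)
Definition positive_definite_kernel (R : realType) (S : Type)
    (kappa : S -> S -> R) : Prop :=
  (forall x x' : S, kappa x x' = kappa x' x) /\
  (forall (n : nat) (z : 'I_n -> S) (a : 'I_n -> R),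
     0 <= \sum_(i < n) \sum_(j < n) a i * a j * kappa (z i) (z j)).

Definition mutually_independent (d : measure_display) (T : measurableType d)
    (R : realType) (P : probability T R) (I : choiceType)
    (F : I -> set (set T)) : Prop :=
  forall (J : {fset I}) (E : I -> set T),
    (forall i, i \in J -> F i (E i)) ->
    P (\bigcap_(i in [set` J]) E i) = (\prod_(i <- J) P (E i))%E.

Definition sigma_algebra_of (d : measure_display) (T : measurableType d)
    (R : realType) (J : Type) (X : J -> T -> R) : set (set T) :=
  <<s [set A | exists (j : J) (B : set R), measurable B /\ A = X j @^-1` B] >>.

(* The process [f] (as a whole) and the noise variables eps_0, eps_1, ... are
   mutually independent; the index [None] stands for [f]. *)
Definition independent_noise (d : measure_display) (T : measurableType d)
    (R : realType) (P : probability T R) (S : Type)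
    (f : S -> {RV P >-> R}) (eps : nat -> {RV P >-> R}) : Prop :=
  mutually_independent P (fun o : option nat =>
    if o is Some n then sigma_algebra_of (fun _ : unit => eps n : T -> R)
    else sigma_algebra_of (fun x : S => f x : T -> R)).

(* The observations are indexed from 0: the first [n] ones are at
   xs 0, ..., xs (n - 1). *)
Definition gram (R : realType) (S : Type) (kappa : S -> S -> R)
    (xs : nat -> S) (n : nat) : 'M[R]_n :=
  \matrix_(i < n, j < n) kappa (xs i) (xs j).

Definition kernel_row (R : realType) (S : Type) (kappa : S -> S -> R)
    (xs : nat -> S) (n : nat) (x : S) : 'rV[R]_n :=
  \row_(j < n) kappa x (xs j).

(* [v] is the assumed Gaussian noise variance. *)
Definition posterior_mean (R : realType) (S : Type) (kappa : S -> S -> R)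
    (v : R) (xs : nat -> S) (y : nat -> R) (n : nat) (x : S) : R :=
  (kernel_row kappa xs n x *m invmx (gram kappa xs n + v%:M)
     *m \col_(i < n) y i) 0 0.

Definition posterior_variance (R : realType) (S : Type) (kappa : S -> S -> R)
    (v : R) (xs : nat -> S) (n : nat) (x : S) : R :=
  kappa x x - (kernel_row kappa xs n x *m invmx (gram kappa xs n + v%:M)
                 *m (kernel_row kappa xs n x)^T) 0 0.

(* Main.v *)
(* Write [A = K_n + sigma^2 I] and [W = kappa(x, X_n) A^-1]. Then
   [f(x) - mu_n(x) = G - \sum_i W_i eps_i] with [G = f(x) - \sum_i W_i f(x_i)]
   a centered Gaussian independent of the noise. By independence the moment
   generating functions multiply, so the error is sub-Gaussian with parameter
   [Var G + sigma^2 \sum_i W_i^2], which equals [sigma_n^2(x)] because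
   [W A = kappa(x, X_n)]. *)
Require Import Defs.
From HB Require Import structures.
From mathcomp Require Import all_boot all_order all_algebra finmap.
From mathcomp Require Import all_classical all_reals all_analysis.
From mathcomp Require Import measurable_realfun random_variable.
From mathcomp Require Import normal_distribution ring lra.

Set Implicit Arguments.
Unset Strict Implicit.
Unset Printing Implicit Defensive.

Import Order.TTheory GRing.Theory Num.Theory.

Local Open Scope classical_set_scope.
Local Open Scope ring_scope.

(** * Image measures weighted by a density *)

Section image_measure_with_density.
Import HBNNSimple.

(** The hypothesis on [nu] is the case of indicators; linearity extends it to simple functions and
    monotone convergence to [phi]. It serves twice below: with [g] a product of other random
    factors, and with [g] a Gaussian density. *)
Lemma ge0_integral_comp_density (d d' : measure_display)
    (T : measurableType d) (T' : measurableType d') (R : realType)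
    (mu : {measure set T -> \bar R}) (nu : {measure set T' -> \bar R})
    (X : T -> T') (g : T -> R) (phi : T' -> R) :
  measurable_fun [set: T] X ->
  measurable_fun [set: T] g -> (forall x, 0 <= g x) ->
  (forall B, measurable B ->
     (\int[mu]_x (\1_B (X x) * g x)%:E)%E = nu B) ->
  measurable_fun [set: T'] phi -> (forall y, 0 <= phi y) ->
  (\int[mu]_x (phi (X x) * g x)%:E = \int[nu]_y (phi y)%:E)%E.
Proof.
move=> mX mg g0 muX mphi phi0.
have mphiE : measurable_fun [set: T'] (EFin \o phi : T' -> \bar R).
  exact/measurable_EFinP.
have phiE0 y : [set: T'] y -> (0 <= (EFin \o phi) y)%E.
  by move=> _; rewrite lee_fin.
pose h := nnsfun_approx measurableT mphiE.
have cvgh y : EFin \o h^~ y @ \oo --> (phi y)%:E.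
  exact: cvg_nnsfun_approx phiE0 _ _.
have ndh y a b : (a <= b)%N -> h a y <= h b y.
  by move=> ab; have /lefP := nd_nnsfun_approx measurableT mphiE ab; exact.
have nuh : (\int[nu]_y (h n y)%:E)%E @[n --> \oo] -->
    (\int[nu]_y (phi y)%:E)%E.
  have -> : (\int[nu]_y (phi y)%:E =
             \int[nu]_y limn (fun n => (h n y)%:E))%E.
    by apply: eq_integral => y _; apply/esym/cvg_lim => //; exact: cvgh.
  apply: cvg_monotone_convergence => //.
  - by move=> n; apply/measurable_EFinP.
  - by move=> n y _; rewrite lee_fin.
  - by move=> y _ a b ab; rewrite lee_fin ndh.
have muh : (\int[mu]_x (h n (X x) * g x)%:E)%E @[n --> \oo] -->
    (\int[mu]_x (phi (X x) * g x)%:E)%E.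
  have -> : (\int[mu]_x (phi (X x) * g x)%:E =
             \int[mu]_x limn (fun n => (h n (X x) * g x)%:E))%E.
    apply: eq_integral => x _; apply/esym/cvg_lim => //.
    under eq_fun do rewrite EFinM; rewrite EFinM.
    by apply: cvgeZr => //; exact: cvgh.
  apply: cvg_monotone_convergence => //.
  - move=> n; apply/measurable_EFinP/measurable_funM => //.
    exact: measurableT_comp.
  - by move=> n x _; rewrite lee_fin mulr_ge0.
  - by move=> x _ a b ab; rewrite lee_fin ler_wpM2r// ndh.
(* Limits being unique, only the simple functions remain; both sides are split along the level sets
   of [h n]. *)
suff eqh n : (\int[mu]_x (h n (X x) * g x)%:E = \int[nu]_y (h n y)%:E)%E.
  rewrite -(cvg_lim _ muh)// -(cvg_lim _ nuh)//.
  by congr (limn _); exact/funext.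
transitivity (\int[mu]_x (\sum_(r \in range (h n))
    r%:E * (\1_(h n @^-1` [set r]) (X x) * g x)%:E))%E.
  apply: eq_integral => x _.
  rewrite fimfunE EFinM -fsumEFin// ge0_mule_fsuml => [|r]; last first.
    exact: nnfun_muleindic_ge0.
  by apply: eq_fsbigr => r _; rewrite !EFinM muleA.
have mind r : measurable_fun [set: T']
    (\1_(h n @^-1` [set r]) : T' -> R).
  exact/measurable_indic/measurable_sfunP.
have mindX r : measurable_fun [set: T]
    (fun x => (\1_(h n @^-1` [set r]) (X x) * g x)%:E : \bar R).
  by apply/measurable_EFinP/measurable_funM => //; exact: measurableT_comp.
have ind0 r x : (0 <= r%:E * (\1_(h n @^-1` [set r]) (X x) * g x)%:E)%E.
  rewrite EFinM muleA; apply: mule_ge0; last by rewrite lee_fin.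
  exact: nnfun_muleindic_ge0.
rewrite ge0_integral_fsum//; last by move=> r; exact: measurable_funeM.
transitivity (\int[nu]_y (\sum_(r \in range (h n))
    (r * \1_(h n @^-1` [set r]) y)%:E))%E; last first.
  by apply: eq_integral => y _; rewrite fimfunE -fsumEFin.
rewrite ge0_integral_fsum//; last 2 first.
- by move=> r; apply/measurable_EFinP/measurable_funM.
- by move=> r y _; exact: nnfun_muleindic_ge0.
apply: eq_fsbigr => r /[!inE] -[y _ <-].
rewrite ge0_integralZl_EFin//; last by move=> x _; rewrite lee_fin mulr_ge0.
rewrite muX; last exact: measurable_sfunP.
under [RHS]eq_integral do rewrite EFinM.
rewrite ge0_integralZl_EFin//; last first.
  exact/measurable_EFinP.
by rewrite integral_indic ?setIT//; exact: measurable_sfunP.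
Qed.

End image_measure_with_density.

(** * Expectations of products under independence *)

Lemma prod_indic (I : choiceType) (R : realType) (T : Type) (r : seq I)
    (A : I -> set T) (w : T) :
  \prod_(i <- r) \1_(A i) w = \1_(\bigcap_(i in [set` r]) A i) w :> R.
Proof.
rewrite bigcap_seq; elim: r => [|i r IHr]; first by rewrite !big_nil indicT.
by rewrite !big_cons IHr indicI.
Qed.

(* The functions [phi i] are traded one at a time for indicators: by
   [ge0_integral_comp_density], the product formula for all indicators in the
   place [k] gives the one for [phi k]. *)
Lemma mutually_independent_integral_prod (d : measure_display)
    (T : measurableType d) (R : realType) (P : probability T R)
    (I : choiceType) (F : I -> set (set T)) (X : I -> T -> R)
    (phi : I -> R -> R) (r : seq I) :
  mutually_independent P F ->
  (forall i, measurable_fun [set: T] (X i)) ->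
  (forall i B, measurable B -> F i (X i @^-1` B)) ->
  (forall i, measurable_fun [set: R] (phi i)) ->
  (forall i y, 0 <= phi i y) ->
  (forall i, (\int[P]_w (phi i (X i w))%:E < +oo)%E) ->
  uniq r ->
  (\int[P]_w (\prod_(i <- r) phi i (X i w))%:E =
   \prod_(i <- r) \int[P]_w (phi i (X i w))%:E)%E.
Proof.
move=> indF mX FX mphi phi0 phioo ur.
(* The indices in [s] already carry [phi], the others still an indicator. The induction on [s] keeps
   [B] general because its step changes the set at the place [k]. *)
pose psi (s : seq I) (B : I -> set R) i : R -> R :=
  if i \in s then phi i else \1_(B i).
suff H s B : (forall i, measurable (B i)) ->
    (\int[P]_w (\prod_(i <- r) psi s B i (X i w))%:E =
     \prod_(i <- r) \int[P]_w (psi s B i (X i w))%:E)%E.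
  have := H r (fun=> setT) (fun=> measurableT).
  under eq_integral do under eq_big_seq => i ir do rewrite /psi ir.
  by move=> ->; apply: eq_big_seq => i ir; rewrite /psi ir.
have psi0 s' B' i y : 0 <= psi s' B' i y.
  by rewrite /psi; case: ifP => // _; rewrite indicE.
have mXB i A : measurable A -> measurable (X i @^-1` A).
  by move=> mA; rewrite -[_ @^-1` _]setTI; exact: mX.
elim: s B => [|k s IHs] B mB.
  under eq_integral do rewrite /psi/= (prod_indic _ r (fun i => X i @^-1` B i)).
  rewrite integral_indic//; last first.
    by rewrite bigcap_seq; apply: bigsetI_measurable => i _; exact: mXB.
  rewrite setIT; pose J := [fset i in r]%fset.
  have -> : [set` r] = [set` J].
    by apply/seteqP; split => i; rewrite /= !inE.
  apply: etrans (indF J (fun i => X i @^-1` B i) _) _ => [i _|].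
    exact: FX.
  rewrite (perm_big r); last first.
    by apply: uniq_perm => // i; rewrite !inE.
  apply: eq_bigr => i _; rewrite /psi/=.
  by rewrite (integral_indic _ measurableT (mXB i (B i) (mB i))) setIT.
have mpsi s' i : measurable_fun [set: R] (psi s' B i).
  by rewrite /psi; case: ifP => // _; exact: measurable_indic.
have [ks|ks] := boolP (k \in s).
  have -> : psi (k :: s) B = psi s B.
    by apply/funext => i; rewrite /psi inE; case: eqVneq => // ->; rewrite ks.
  exact: IHs.
have psi_k i C : i != k ->
    psi (k :: s) B i = psi s (fun j => if j == k then C else B j) i.
  by move=> ik; rewrite /psi inE (negbTE ik).
have [kr|kr] := boolP (k \in r); last first.
  have E i : i \in r -> psi (k :: s) B i = psi s B i.
    move=> ir; rewrite (psi_k _ (B k)); last by apply: contraNneq kr => <-.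
    by rewrite /psi; case: eqVneq => // ->.
  under eq_integral do under eq_big_seq => i ir do rewrite E//.
  by rewrite IHs//; apply: eq_big_seq => i ir; rewrite E.
have psioo s' B' i : (forall j, measurable (B' j)) ->
    (\int[P]_w (psi s' B' i (X i w))%:E < +oo)%E.
  move=> mB'; rewrite /psi; case: ifP => // _.
  rewrite (integral_indic _ measurableT (mXB i (B' i) (mB' i))) setIT.
  by rewrite (le_lt_trans (probability_le1 _ _)) ?ltry//; exact: mXB.
(* The other factors act as a density [H]: by the induction hypothesis, the image under [X k] of [P]
   weighted by [H] is [c] times the law of [X k]. Finiteness of the integrals makes [c] a real
   number. *)
pose H w := \prod_(i <- r | i != k) psi (k :: s) B i (X i w).
have H0 w : 0 <= H w by exact: prodr_ge0.
have mH : measurable_fun [set: T] H.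
  rewrite /H; under eq_fun do rewrite -big_filter.
  apply: measurable_prod => i _; exact: measurableT_comp.
pose c := fine (\prod_(i <- r | i != k)
  \int[P]_w (psi (k :: s) B i (X i w))%:E)%E.
have I0 i : (0 <= \int[P]_w (psi (k :: s) B i (X i w))%:E)%E.
  by apply: integral_ge0 => w _; rewrite lee_fin.
have cE : (\prod_(i <- r | i != k)
    \int[P]_w (psi (k :: s) B i (X i w))%:E = c%:E)%E.
  rewrite fineK// prode_fin_num// => i _.
  by rewrite ge0_fin_numE// psioo.
have c0 : 0 <= c by rewrite fine_ge0// prode_ge0.
pose Y : {mfun T >-> R} := mfun_Sub (mem_set (mX k) : X k \in mfun).
pose nu := mscale (NngNum c0) (distribution P Y).
have psiE w : \prod_(i <- r) psi (k :: s) B i (X i w) = phi k (X k w) * H w.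
  by rewrite (bigD1_seq k)//= {1}/psi mem_head.
under eq_integral do rewrite psiE.
rewrite (@ge0_integral_comp_density _ _ _ _ _ P nu (X k) H)//; last first.
  move=> C mC; pose B' j := if j == k then C else B j.
  have mB' j : measurable (B' j) by rewrite /B'; case: ifP.
  have psi_kC : psi s B' k = \1_C by rewrite /psi (negbTE ks) /B' eqxx.
  have -> : (\int[P]_w (\1_C (X k w) * H w)%:E =
             \int[P]_w (\prod_(i <- r) psi s B' i (X i w))%:E)%E.
    apply: eq_integral => w _; rewrite (bigD1_seq k)//= psi_kC /H.
    by congr (_ * _)%:E; apply: eq_bigr => i ik; rewrite (psi_k _ C).
  rewrite IHs// (bigD1_seq k)//= psi_kC.
  rewrite (integral_indic _ measurableT (mXB k C mC)) setIT /nu /mscale/=.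
  rewrite muleC -cE; congr (_ * _)%E; apply: eq_bigr => i ik.
  by rewrite (psi_k _ C).
rewrite ge0_integral_mscale//=; last 2 first.
- exact/measurable_EFinP.
- by move=> y _; rewrite lee_fin.
rewrite ge0_integral_distribution//; last 2 first.
- exact/measurable_EFinP.
- by move=> y; rewrite lee_fin.
by rewrite (bigD1_seq k)//= cE muleC /psi mem_head.
Qed.

(** * Gaussian laws: exponential integrals and identification of the parameters *)

Lemma integral_normal_law (d : measure_display) (T : measurableType d)
    (R : realType) (P : probability T R) (G : {RV P >-> R}) (m s : R)
    (phi : R -> R) :
  (forall A, measurable A -> P (G @^-1` A) = normal_prob m s A) ->
  measurable_fun [set: R] phi -> (forall x, 0 <= phi x) ->
  (\int[P]_w (phi (G w))%:E =
   \int[lebesgue_measure]_x (phi x * normal_pdf m s x)%:E)%E.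
Proof.
move=> lawG mphi phi0.
transitivity (\int[distribution P G]_x (phi x)%:E)%E.
  by rewrite ge0_integral_distribution//; exact/measurable_EFinP.
apply: esym.
apply: (@ge0_integral_comp_density _ _ _ _ _ lebesgue_measure
  (distribution P G) idfun (normal_pdf m s) phi) => //.
- exact: measurable_id.
- exact: measurable_normal_pdf.
- exact: normal_pdf_ge0.
move=> B mB; rewrite [RHS]lawG// /normal_prob [RHS]integral_mkcond.

by apply: eq_integral => x _; rewrite epatch_indic/= muleC.
Qed.

Lemma gaussian_law_mgf (d : measure_display) (T : measurableType d)
    (R : realType) (P : probability T R) (G : {RV P >-> R}) (m s t : R) :
  (forall A, measurable A -> P (G @^-1` A) = gaussian_law m s A) ->
  (\int[P]_w (expR (t * G w))%:E = (expR (t * m + t ^+ 2 * s ^+ 2 / 2))%:E)%E.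
Proof.
have mexp : measurable_fun [set: R] (fun x => expR (t * x)).
  by apply: measurableT_comp => //; exact: measurable_funM.
rewrite /gaussian_law; have [->|s0] := eqVneq s 0 => lawG.
  transitivity (\int[distribution P G]_x (expR (t * x))%:E)%E.
    by rewrite ge0_integral_distribution//; exact/measurable_EFinP.
  rewrite (eq_measure_integral \d_m) => [|A mA _]; last exact: lawG.
  rewrite integral_dirac//; last exact/measurable_EFinP.
  by rewrite diracT mul1e expr0n/= mulr0 mul0r addr0.
rewrite (integral_normal_law lawG mexp)//.
(* Completing the square: the factor [expR (t * x)] shifts the mean of the normal density by
   [t * s ^+ 2], up to a constant. *)
transitivity (\int[lebesgue_measure]_x
  ((expR (t * m + t ^+ 2 * s ^+ 2 / 2))%:E *
   (normal_pdf (m + t * s ^+ 2) s x)%:E))%E.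
  apply: eq_integral => x _; rewrite -EFinM; congr EFin.
  rewrite !normal_pdfE// mulrCA [RHS]mulrCA /normal_fun -!expRD.
  by congr (_ * expR _); field; rewrite s0.
rewrite ge0_integralZl_EFin ?expR_ge0//.
- by rewrite integral_normal_pdf mule1.
- by move=> x _; rewrite lee_fin normal_pdf_ge0.
- by apply/measurable_EFinP; exact: measurable_normal_pdf.
Qed.

(** [gaussian_rv] provides parameters without relating them to moments. Here the exponent
    [t * m + t ^+ 2 * s ^+ 2 / 2] is nonnegative for every [t], which forces its linear coefficient
    to vanish. *)
Lemma gaussian_law_mean0 (d : measure_display) (T : measurableType d)
    (R : realType) (P : probability T R) (G : {RV P >-> R}) (m s : R) :
  (forall A, measurable A -> P (G @^-1` A) = gaussian_law m s A) ->
  (G : T -> R) \in Lfun P 1 -> ('E_P[G] = 0)%E -> m = 0.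
Proof.
move=> lawG G1 EG.
(* [1 + u <= exp u] makes the moment generating function at least [1]. *)
have mgf_ge1 t : 1 <= expR (t * m + t ^+ 2 * s ^+ 2 / 2).
  rewrite -lee_fin -(gaussian_law_mgf t lawG).
  have intG : P.-integrable [set: T] (EFin \o G) by exact/Lfun1_integrable.
  have int1 : P.-integrable [set: T] (cst 1%E).
    exact: finite_measure_integrable_cst.
  have inttG : P.-integrable [set: T] (fun w => t%:E * (G w)%:E)%E.
    exact: integrableZl.
  have -> : 1%E = (\int[P]_w (1 + t%:E * (G w)%:E))%E.
    rewrite integralD// integral_cst//= mul1e probability_setT integralZl//.
    by move: EG; rewrite unlock => ->; rewrite mule0 adde0.
  apply: le_integral => //; first exact: integrableD.
    apply/integrableP; split.
      apply/measurable_EFinP/measurableT_comp => //.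
      exact: measurable_funM.
    under eq_integral do rewrite gee0_abs ?lee_fin ?expR_ge0//.
    by rewrite (gaussian_law_mgf t lawG) ltry.
  by move=> w _; rewrite -EFinM -EFinD lee_fin expR_ge1Dx.
have [s0|s0] := eqVneq s 0.
  have := mgf_ge1 (- m); rewrite s0 -[leLHS]expR0 ler_expR expr0n/=.
  rewrite mulr0 mul0r addr0 mulNr oppr_ge0 -expr2.
  rewrite real_exprn_even_le0//= ?num_real//.
  by move/eqP.
(* This [t] minimizes the exponent; the minimum is [- ((m / s) ^+ 2 / 2)]. *)
have := mgf_ge1 (- m / s ^+ 2); rewrite -[leLHS]expR0 ler_expR.
have -> : (- m / s ^+ 2) * m + (- m / s ^+ 2) ^+ 2 * s ^+ 2 / 2 =
    - ((m / s) ^+ 2 / 2) by field.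
rewrite oppr_ge0 pmulr_lle0// real_exprn_even_le0//= ?num_real//.
by rewrite mulf_eq0 invr_eq0 (negbTE s0) orbF => /eqP.
Qed.

(** The coefficient is chosen so that the exponential turns the density of N(0, s^2) into [theta]
    times that of N(0, (theta s)^2), whose mass is one. *)
Lemma normal_law_integral_gauss (d : measure_display) (T : measurableType d)
    (R : realType) (P : probability T R) (G : {RV P >-> R}) (s theta : R) :
  s != 0 -> 0 < theta ->
  (forall A, measurable A -> P (G @^-1` A) = normal_prob 0 s A) ->
  (\int[P]_w (expR (- ((theta ^-2 - 1) / (2 * s ^+ 2) * G w ^+ 2)))%:E
   = theta%:E)%E.
Proof.
move=> s0 theta0 lawG.
rewrite (@integral_normal_law _ _ _ _ _ _ _
  (fun x => expR (- ((theta ^-2 - 1) / (2 * s ^+ 2) * x ^+ 2)))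
  lawG)//; last first.
  apply: measurableT_comp => //; apply: measurable_funN.
  by apply: measurable_funM => //; exact: measurable_funX.
have ts0 : theta * s != 0 by rewrite mulf_neq0// gt_eqF.
transitivity (\int[lebesgue_measure]_x
  (theta%:E * (normal_pdf 0 (theta * s) x)%:E))%E.
  apply: eq_integral => x _; rewrite -EFinM; congr EFin.
  rewrite !normal_pdfE// mulrCA [RHS]mulrA /normal_fun -expRD.
  congr (_ * expR _); last by field; rewrite s0 gt_eqF.
  rewrite /normal_peak.
  have -> : (theta * s) ^+ 2 * pi *+ 2 = theta ^+ 2 * (s ^+ 2 * pi *+ 2).
    by rewrite exprMn -mulrA mulrnAr.
  rewrite sqrtrM ?sqr_ge0// sqrtr_sqr gtr0_norm// invfM mulrA divff ?mul1r//.
  by rewrite gt_eqF.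
rewrite ge0_integralZl_EFin ?(ltW theta0)//.
- by rewrite integral_normal_pdf mule1.
- by move=> x _; rewrite lee_fin normal_pdf_ge0.
- by apply/measurable_EFinP; exact: measurable_normal_pdf.
Qed.

(* Let [theta] tend to [1] in [theta = E(exp (- c G ^+ 2)) >= 1 - c E(G ^+ 2)]
   where [c = (theta ^-2 - 1) / (2 * s ^+ 2)]. *)
Lemma gaussian_law_variance_le (d : measure_display) (T : measurableType d)
    (R : realType) (P : probability T R) (G : {RV P >-> R}) (s v : R) :
  (forall A, measurable A -> P (G @^-1` A) = gaussian_law 0 s A) ->
  (\int[P]_w (G w ^+ 2)%:E = v%:E)%E -> s ^+ 2 <= v.
Proof.
have [-> lawG Gv|s0] := eqVneq s 0.
  rewrite expr0n -lee_fin -Gv integral_ge0// => w _.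
  by rewrite lee_fin sqr_ge0.
rewrite /gaussian_law (negbTE s0) => lawG Gv.
have v0 : 0 <= v.
  by rewrite -lee_fin -Gv integral_ge0// => w _; rewrite lee_fin sqr_ge0.
have s2 : 0 < s ^+ 2 by rewrite exprn_even_gt0.
have mG2 : measurable_fun [set: T] (fun w => G w ^+ 2).
  exact: measurable_funX.
have sub theta : 0 < theta < 1 -> (2 * theta - 1) * s ^+ 2 <= v.
  move=> /andP[t0 t1]; pose c := (theta ^-2 - 1) / (2 * s ^+ 2).
  have c0 : 0 <= c.
    apply: divr_ge0; last by rewrite mulr_ge0// ltW.
    by rewrite subr_ge0 invf_ge1 ?exprn_gt0// exprn_ile1// ltW.
  have : 1 <= theta + c * v.
    rewrite -lee_fin EFinD EFinM -Gv -(normal_law_integral_gauss s0 t0 lawG).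
    rewrite -ge0_integralZl_EFin//; last 2 first.
    - by move=> w _; rewrite lee_fin sqr_ge0.
    - exact/measurable_EFinP.
    have mexp : measurable_fun [set: T] (fun w => expR (- (c * G w ^+ 2))).
      apply: measurableT_comp => //.
      by apply: measurable_funN; exact: measurable_funM.
    have mcG : measurable_fun [set: T] (fun w => c * G w ^+ 2).
      exact: measurable_funM.
    rewrite -ge0_integralD//; last 3 first.
    - exact/measurable_EFinP.
    - by move=> w _; rewrite -EFinM lee_fin mulr_ge0 ?sqr_ge0.
    - by under eq_fun do rewrite -EFinM; exact/measurable_EFinP.
    have -> : 1%E = (\int[P]_w cst 1%E w)%E.
      by rewrite integral_cst//= mul1e probability_setT.
    apply: ge0_le_integral => //.
    - under eq_fun do rewrite -EFinM -EFinD.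
      by apply/measurable_EFinP; exact: measurable_funD.
    - move=> w _; rewrite -EFinM -EFinD lee_fin -/c.
      by rewrite -lerBlDr expR_ge1Dx.
  have -> : theta + c * v = theta +
      (1 - theta) * ((1 + theta) * v) / (2 * theta ^+ 2 * s ^+ 2).
    by rewrite /c; field; rewrite s0 gt_eqF.
  rewrite -lerBlDl -mulrA ler_pMr ?subr_gt0//.
  have b0 : 0 < 2 * theta ^+ 2 * s ^+ 2.
    by apply: mulr_gt0 => //; apply: mulr_gt0 => //; exact: exprn_gt0.
  rewrite ler_pdivlMr// mul1r.
  (* The premise is now [2 * theta ^+ 2 * s ^+ 2 <= (1 + theta) * v], and [(2 * theta - 1) * (1 +
     theta) <= 2 * theta ^+ 2] as [theta < 1]. *)
  nra.
rewrite leNgt; apply/negP => vs.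
(* [q] is the midpoint of [v / s ^+ 2] and 1. Taking [theta = (1 + q) / 2] gives
   [2 * theta - 1 = q], while [q * s ^+ 2] exceeds [v]. *)
pose q := (v + s ^+ 2) / (2 * s ^+ 2).
have d0 : 0 < 2 * s ^+ 2 by lra.
have q0 : 0 < q by rewrite divr_gt0//; lra.
have q1 : q < 1 by rewrite ltr_pdivrMr//; lra.
have /sub : 0 < (1 + q) / 2 < 1 by apply/andP; split; lra.
have -> : (2 * ((1 + q) / 2) - 1) * s ^+ 2 = (v + s ^+ 2) / 2.
  by rewrite /q; field.
by lra.
Qed.

(** The one-sided bound [s ^+ 2 <= v] suffices, the exponent being increasing in the variance. *)
Lemma gaussian_rv_mgf_le (d : measure_display) (T : measurableType d)
    (R : realType) (P : probability T R) (G : T -> R) (v : R) :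
  gaussian_rv P G -> G \in Lfun P 1 -> ('E_P[G] = 0)%E ->
  (\int[P]_w (G w ^+ 2)%:E = v%:E)%E ->
  forall t, (\int[P]_w (expR (t * G w))%:E <= (expR (t ^+ 2 * v / 2))%:E)%E.
Proof.
move=> [mG [m [s lawG]]] G1 EG Gv t.
pose Y : {mfun T >-> R} := mfun_Sub (mem_set mG : G \in mfun).
have m0 : m = 0 by apply: (@gaussian_law_mean0 _ _ _ _ Y m s lawG).
rewrite m0 in lawG.
have sv : s ^+ 2 <= v by apply: (@gaussian_law_variance_le _ _ _ _ Y s v lawG).
rewrite (@gaussian_law_mgf _ _ _ _ Y _ _ _ lawG) lee_fin ler_expR mulr0 add0r.
by rewrite ler_pM2r// ler_wpM2l ?sqr_ge0.
Qed.

(** * Linear combinations: moments and measurability *)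

Lemma centered_covarianceE (d : measure_display) (T : measurableType d)
    (R : realType) (P : probability T R) (X Y : T -> R) :
  ('E_P[X] = 0)%E -> ('E_P[Y] = 0)%E ->
  covariance P X Y = (\int[P]_w (X w * Y w)%:E)%E.
Proof.
move=> X0 Y0; rewrite covariance.unlock X0 Y0 /= unlock.
by apply: eq_integral => w _; rewrite -[X w in RHS]subr0 -[Y w in RHS]subr0.
Qed.

(** Domination by |xy| <= x^2 + y^2. *)
Lemma integrable_mul_sqr (d : measure_display) (T : measurableType d)
    (R : realType) (mu : {measure set T -> \bar R}) (X Y : {mfun T >-> R}) :
  mu.-integrable [set: T] (fun w => (X w ^+ 2)%:E) ->
  mu.-integrable [set: T] (fun w => (Y w ^+ 2)%:E) ->
  mu.-integrable [set: T] (fun w => (X w * Y w)%:E).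
Proof.
move=> X2 Y2; have XY2 := integrableD measurableT X2 Y2.
apply: le_integrable XY2 => //.
  by apply/measurable_EFinP; exact: measurable_funM.
move=> w _; rewrite -EFinD !abse_EFin lee_fin [leRHS]ger0_norm; last first.
  by rewrite addr_ge0// sqr_ge0.
by rewrite ler_norml; apply/andP; split; nra.
Qed.

(** Integrability comes from the covariances being real numbers: the diagonal ones make each [X i]
    square integrable, hence all products integrable, and [X i] itself as its product with the
    constant 1. *)
Lemma centered_lincomb_moments (d : measure_display) (T : measurableType d)
    (R : realType) (P : probability T R) (n : nat)
    (X : 'I_n -> {RV P >-> R}) (K : 'I_n -> 'I_n -> R) (a : 'I_n -> R) :
  (forall i, 'E_P[X i] = 0)%E ->
  (forall i j, covariance P (X i) (X j) = (K i j)%:E) ->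
  let G w := \sum_(i < n) a i * X i w in
  [/\ G \in Lfun P 1, ('E_P[G] = 0)%E &
      (\int[P]_w (G w ^+ 2)%:E =
       (\sum_(i < n) \sum_(j < n) a i * a j * K i j)%:E)%E].
Proof.
move=> X0 XK G.
have intXX i j : (\int[P]_w (X i w * X j w)%:E = (K i j)%:E)%E.
  by rewrite -centered_covarianceE.
have X2 i : P.-integrable [set: T] (fun w => (X i w ^+ 2)%:E).
  apply/integrableP; split; first by apply/measurable_EFinP/measurable_funX.
  under eq_integral do rewrite gee0_abs ?lee_fin ?sqr_ge0// expr2.
  by rewrite intXX ltry.
have XX i j : P.-integrable [set: T] (fun w => (X i w * X j w)%:E).
  exact: integrable_mul_sqr.
have X1 i : P.-integrable [set: T] (fun w => (X i w)%:E).
  have one2 : P.-integrable [set: T] (fun w => ((cst 1 w : R) ^+ 2)%:E).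
    by under eq_fun do rewrite expr1n; exact: finite_measure_integrable_cst.
  have := integrable_mul_sqr (X2 i) one2.
  by under eq_fun do rewrite mulr1.
have aX1 i : P.-integrable [set: T] (fun w => (a i)%:E * (X i w)%:E)%E.
  exact: integrableZl.
have GE : EFin \o G = (fun w => \sum_(i < n) ((a i)%:E * (X i w)%:E)%E).
  by apply/funext => w; rewrite /= /G -sumEFin.
split.
- by apply/Lfun1_integrable; rewrite GE; exact: integrable_sum.
- rewrite unlock (_ : (fun w => (G w)%:E) = EFin \o G)// GE integral_sum//.
  apply: big1 => i _; rewrite integralZl//.
  by have := X0 i; rewrite unlock => ->; rewrite mule0.
- have aXX i j : P.-integrable [set: T]
      (fun w => (a i * a j)%:E * (X i w * X j w)%:E)%E.
    exact: integrableZl.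
  transitivity (\int[P]_w (\sum_(i < n) \sum_(j < n)
      ((a i * a j)%:E * (X i w * X j w)%:E)))%E.
    apply: eq_integral => w _.
    under eq_bigr do rewrite sumEFin; rewrite sumEFin; congr EFin.
    rewrite expr2 /G mulr_suml; apply: eq_bigr => i _.
    by rewrite mulr_sumr; apply: eq_bigr => j _; rewrite mulrACA.
  rewrite integral_sum// => [|i]; last exact: integrable_sum.
  rewrite -sumEFin; apply: eq_bigr => i _; rewrite integral_sum//.
  rewrite -sumEFin; apply: eq_bigr => j _.
  by rewrite integralZl// intXX.
Qed.

(** This lets independence of the noise from the whole process apply to the Gaussian part of the
    error. *)
Lemma sigma_algebra_of_lincomb (d : measure_display) (T : measurableType d)
    (R : realType) (J : Type) (X : J -> T -> R) (n : nat) (z : 'I_n -> J)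
    (a : 'I_n -> R) (B : set R) : measurable B ->
  sigma_algebra_of X ((fun w => \sum_(i < n) a i * X (z i) w) @^-1` B).
Proof.
pose G := [set A | exists (j : J) (B : set R),
  measurable B /\ A = X j @^-1` B].
have mX j : measurable_fun [set: g_sigma_algebraType G] (X j).
  move=> _ C mC; rewrite setTI; apply: sub_sigma_algebra.
  by exists j, C.
move=> mB; have mS : measurable_fun [set: g_sigma_algebraType G]
    (fun w => \sum_(i < n) a i * X (z i) w).
  by apply: measurable_sum => i; exact: measurable_funM.
by have := mS measurableT B mB; rewrite setTI.
Qed.

(** * Linear algebra of the posterior *)

Lemma posdef_kernel_addr_scalar_unitmx (R : realType) (S : Type)
    (kappa : S -> S -> R) (xs : nat -> S) (n : nat) (v : R) :
  positive_definite_kernel kappa -> 0 < v ->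
  gram kappa xs n + v%:M \in unitmx.
Proof.
move=> [_ kpsd] v0; rewrite -row_free_unit; apply/inj_row_free => u uA0.
(* For [u] in the left kernel, the quadratic form of the Gram matrix at [u] equals [- v] times the
   squared norm of [u]; being nonnegative, it forces [u = 0]. *)
have q0 : (u *m (gram kappa xs n + v%:M) *m u^T) 0 0 = 0.
  by rewrite uA0 mul0mx mxE.
have := kpsd n xs (u 0).
have -> : \sum_(i < n) \sum_(j < n) u 0 i * u 0 j * kappa (xs i) (xs j) =
    - (v * \sum_(i < n) u 0 i ^+ 2).
  apply/eqP; rewrite -addr_eq0; apply/eqP; rewrite -[RHS]q0.
  rewrite mulmxDr mulmxDl mul_mx_scalar -scalemxAl !mxE.
  congr (_ + v * _); last by apply: eq_bigr => i _; rewrite mxE expr2.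
  rewrite exchange_big/=; apply: eq_bigr => j _.
  rewrite !mxE mulr_suml; apply: eq_bigr => i _.
  by rewrite mxE mulrAC.
rewrite oppr_ge0 pmulr_rle0// => s0.
have : \sum_(i < n) u 0 i ^+ 2 == 0.
  by rewrite eq_le s0 sumr_ge0// => i _; exact: sqr_ge0.
rewrite psumr_eq0 => [/allP u0|i _]; last exact: sqr_ge0.
apply/rowP => i; rewrite mxE; apply/eqP.
by have := u0 i (mem_index_enum i); rewrite sqrf_eq0.
Qed.

(* The left-hand side is the mean squared error of the linear predictor of
   [f x] with weights [W] under noise of variance [v]. *)
Lemma posterior_varianceE (R : realType) (S : Type) (kappa : S -> S -> R)
    (xs : nat -> S) (n : nat) (v : R) (x : S) :
  (forall x x', kappa x x' = kappa x' x) ->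
  gram kappa xs n + v%:M \in unitmx ->
  let W := kernel_row kappa xs n x *m invmx (gram kappa xs n + v%:M) in
  kappa x x - 2 * (\sum_(i < n) W 0 i * kappa x (xs i)) +
    \sum_(i < n) \sum_(j < n) W 0 i * W 0 j * kappa (xs i) (xs j) +
    v * (\sum_(i < n) W 0 i ^+ 2) =
  posterior_variance kappa v xs n x.
Proof.
move=> ksym uA W.
have WA : W *m (gram kappa xs n + v%:M) = kernel_row kappa xs n x.
  by rewrite /W mulmxKV.
have kW : \sum_(i < n) W 0 i * kappa x (xs i) =
    (W *m (kernel_row kappa xs n x)^T) 0 0.
  by rewrite mxE; apply: eq_bigr => i _; rewrite !mxE.
rewrite /posterior_variance -/W -kW; clearbody W.
(* This is [WA] multiplied on the right by the transpose of [W]; it merges the quadratic and noise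
   terms with half of the cross term. *)
suff -> : \sum_(i < n) W 0 i * kappa x (xs i) =
    \sum_(i < n) \sum_(j < n) W 0 i * W 0 j * kappa (xs i) (xs j) +
    v * (\sum_(i < n) W 0 i ^+ 2) by ring.
rewrite mulr_sumr -big_split/=; apply: eq_bigr => i _.
have -> : kappa x (xs i) = (W *m (gram kappa xs n + v%:M)) 0 i.
  by rewrite WA mxE.
rewrite mulmxDr mul_mx_scalar !mxE mulrDr; congr (_ + _); last by ring.
rewrite mulr_sumr; apply: eq_bigr => j _; rewrite mxE (ksym (xs j)); ring.
Qed.

(** * Sub-Gaussianity of the prediction error *)

Theorem lemmaC1 (d : measure_display) (T : measurableType d) (R : realType)
    (P : probability T R) (S : Type) (kappa : S -> S -> R)
    (f : S -> {RV P >-> R}) (sigma_eps : R)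
    (xs : nat -> S) (eps y : nat -> {RV P >-> R})
    (kappa_pd : positive_definite_kernel kappa)
    (f_gp : gaussian_process (fun _ : S => 0) kappa f)
    (eps_subgaussian : forall n : nat, subgaussian P (sigma_eps ^+ 2) (eps n))
    (noise_independent : independent_noise f eps)
    (y_obs : forall (n : nat) (w : T), y n w = f (xs n) w + eps n w)
    (n : nat)
    (posterior_defined : sigma_eps = 0 -> gram kappa xs n \in unitmx)
    (x : S) :
  subgaussian P (posterior_variance kappa (sigma_eps ^+ 2) xs n x)
    (fun w => f x w
       - posterior_mean kappa (sigma_eps ^+ 2) xs (fun i => y i w) n x).
Proof.
(* [invmx] is a true inverse here: by [posterior_defined] in the noiseless case, by positivity of
   the noise variance otherwise. *)
have uA : gram kappa xs n + (sigma_eps ^+ 2)%:M \in unitmx.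
  have [s0|s0] := eqVneq sigma_eps 0.
    by rewrite s0 expr0n/= raddf0 addr0; exact: posterior_defined.
  apply: posdef_kernel_addr_scalar_unitmx => //.
  by rewrite exprn_even_gt0.
have [ksym _] := kappa_pd.
have := posterior_varianceE x ksym uA.
set W := kernel_row kappa xs n x *m _ => /= varE.
(* Index [ord0] stands for the target [x] with coefficient 1, and [lift ord0 j] for the observation
   [j] with coefficient [- W 0 j], so that [G] is one combination of [n.+1] process values. *)
pose z (i : 'I_n.+1) := if unlift ord0 i is Some j then xs j else x.
pose a (i : 'I_n.+1) := if unlift ord0 i is Some j then - W 0 j else 1.
pose G (w : T) := \sum_(i < n.+1) a i * f (z i) w.
have a0 : a ord0 = 1 by rewrite /a unlift_none.
have aS j : a (lift ord0 j) = - W 0 j by rewrite /a liftK.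
have z0 : z ord0 = x by rewrite /z unlift_none.
have zS j : z (lift ord0 j) = xs j by rewrite /z liftK.
have errE w : f x w
    - posterior_mean kappa (sigma_eps ^+ 2) xs (fun i => y i w) n x =
    G w - \sum_(j < n) W 0 j * eps j w.
  rewrite /posterior_mean -/W mxE /G big_ord_recl a0 z0 mul1r -addrA.
  congr (_ + _); rewrite -!sumrN -big_split/=; apply: eq_bigr => j _.
  by rewrite mxE y_obs aS zS; ring.
have [f_gauss f0 f_cov] := f_gp.
have G_gauss : gaussian_rv P G by exact: f_gauss.
have [mG _] := G_gauss.
have [G1 EG G2] := @centered_lincomb_moments _ _ _ P _ (fun i => f (z i))
  (fun i j => kappa (z i) (z j)) a (fun i => f0 (z i))
  (fun i j => f_cov (z i) (z j)).
set tau2 := \sum_(i < n.+1) _ in G2.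
(* Splitting off [ord0] in both sums of [tau2] gives [kappa x x], two cross terms equal by symmetry,
   and the quadratic form in [W]. *)
have tau2E : tau2 + sigma_eps ^+ 2 * (\sum_(j < n) W 0 j ^+ 2) =
    posterior_variance kappa (sigma_eps ^+ 2) xs n x.
  rewrite -varE; congr (_ + _); rewrite /tau2 big_ord_recl big_ord_recl/=.
  rewrite a0 z0 !mul1r -!addrA; congr (_ + _).
  under [X in X + _ = _]eq_bigr do rewrite aS zS mul1r mulNr.
  under [X in _ + X = _]eq_bigr => i _.
    rewrite big_ord_recl a0 z0 aS zS mulr1 (ksym _ x) mulNr.
    under eq_bigr do rewrite aS zS mulrNN.
    over.
  by rewrite big_split/= !sumrN; ring.
have mgfG := gaussian_rv_mgf_le G_gauss G1 EG G2.
(* The independent family is indexed by [option nat], so the weights are extended by 0 beyond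
   [n]. *)
pose wt (k : nat) := if insub k is Some j then W 0 j else 0.
have wtE (j : 'I_n) : wt j = W 0 j by rewrite /wt valK.
split.
  under eq_fun do rewrite errE; apply: measurable_funB => //.
  by apply: measurable_sum => j; exact: measurable_funM.
move=> s; rewrite unlock.
pose X (o : option nat) : T -> R := if o is Some k then eps k else G.
pose phi (o : option nat) (u : R) :=
  if o is Some k then expR (- (s * wt k) * u) else expR (s * u).
pose bound (o : option nat) : R := if o is Some k
  then expR ((s * wt k) ^+ 2 * sigma_eps ^+ 2 / 2)
  else expR (s ^+ 2 * tau2 / 2).
have phi_le o : (\int[P]_w (phi o (X o w))%:E <= (bound o)%:E)%E.
  case: o => [k|]; last exact: mgfG.
  have [_ /(_ (- (s * wt k)))] := eps_subgaussian k.
  by rewrite unlock sqrrN.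
pose r := None :: [seq Some (val j) | j <- enum 'I_n].
have prodE w : expR (s * (G w - \sum_(j < n) W 0 j * eps j w)) =
    \prod_(o <- r) phi o (X o w).
  rewrite big_cons big_map big_enum/= -expR_sum -expRD mulrBr.
  congr (expR (_ + _)); rewrite mulr_sumr -sumrN; apply: eq_bigr => j _.
  by rewrite wtE; ring.
under eq_integral do rewrite errE prodE.
rewrite (mutually_independent_integral_prod noise_independent).
- apply: (@le_trans _ _ (\prod_(o <- r) (bound o)%:E)%E).
    elim: (r) => [|o r' IHr]; first by rewrite !big_nil.
    rewrite !big_cons; apply: lee_pmul => //.
      by apply: integral_ge0 => w _; rewrite lee_fin; case: o => [k|] /=.
    apply: prode_ge0 => o' _; apply: integral_ge0 => w _.
    by rewrite lee_fin; case: o' => [k|] /=.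
  rewrite prodEFin lee_fin big_cons big_map big_enum/= -expR_sum -expRD.
  rewrite ler_expR -tau2E le_eqVlt; apply/orP; left; apply/eqP.
  rewrite mulrDr mulrDl; congr (_ + _).
  rewrite mulr_sumr mulr_sumr mulr_suml; apply: eq_bigr => j _.
  by rewrite wtE; ring.
- by case.
- case=> [k|] B mB; last exact: sigma_algebra_of_lincomb.
  by apply: sub_sigma_algebra; exists tt, B.
- by case=> [k|]; apply: measurableT_comp => //; exact: measurable_funM.
- by case=> [k|] u; exact: expR_ge0.
(* The bounds on the moment generating functions also give the finiteness that the product formula
   asks for. *)
- by move=> o; rewrite (le_lt_trans (phi_le o))// ltry.
- rewrite /= map_inj_uniq ?enum_uniq ?andbT; last by move=> i j [] /val_inj.
  by apply/mapP => -[].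
Qed.
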